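(* Let $P=\{p_1,\ldots,p_m\}$ be a finite poset numbered so that $p_i<p_j$ implies $i<j$, let $A_1,\ldots,A_m$ be non-empty subsets of $[n]$, and let $\mathfrak{A}$ be a poset ideal of $\mathrm{Hom}(P,A_1,\ldots,A_m)$. For $t\ge0$, the minimal generating set of $\mathrm{HS}_t(\mathcal{L}(\mathfrak{A}))$ consists of all monomials $$X_{p_1,K_1}X_{p_2,K_2}\cdots X_{p_m,K_m}$$ such that (1) $\emptyset\ne K_i\subseteq A_i$ for all $i\in[m]$; (2) $\max(K_i)\le\min(K_j)$ if $p_i<p_j$; (3) $|K_1|+\cdots+|K_m|=m+t$; (4) the map $(\widehat{K_1},\widehat{K_2},\ldots,\widehat{K_m})$ belongs to $\mathfrak{A}$.
   Context: $n$ is a positive integer, $[n]=\{1,\ldots,n\}$, $\mathbf{K}$ is a field, $R=\mathbf{K}[X_{p,i}\mid p\in P,\ i\in[n]]$. $\mathrm{Hom}(P,A_1,\ldots,A_m)$ is the set of maps $f:P\to[n]$ that are isotone ($p\le q$ implies $f(p)\le f(q)$) with $f(p_i)\in A_i$ for all $i$, partially ordered by $f\le g$ iff $f(p)\le g(p)$ for all $p$. The vector $(a_1,\ldots,a_m)$ denotes the map with $p_i\mapsto a_i$. A poset ideal of a poset $Q$ is a non-empty subset $I\subseteq Q$ such that $y\in I$, $x\in Q$, $x\le y$ imply $x\in I$. For $f$ isotone, $U_f:=\prod_{p\in P}X_{p,f(p)}$, and $\mathcal{L}(\mathfrak{A}):=(U_f\mid f\in\mathfrak{A})\subseteq R$.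 For a non-empty $K\subseteq[n]$, $\widehat{K}:=\max(K)$ and $X_{p_i,K}:=\prod_{a\in K}X_{p_i,a}$. Homological shift ideals: if a monomial ideal $I\subseteq R$ has minimal multigraded free resolution $0\to F_p\to\cdots\to F_0\to I\to0$ with $F_t=\bigoplus_{j=1}^{\beta_t(I)}R(-\mathbf{a}_{t,j})$, then $\mathrm{HS}_t(I):=(X^{\mathbf{a}_{t,j}}\mid j=1,\ldots,\beta_t(I))$ (which is $(0)$ for $t>p=\mathrm{pd}(I)$). *)

(* Defs.v *)
From HB Require Import structures.
From mathcomp Require Import all_boot all_order all_algebra.
From mathcomp Require Import mpoly.

Set Implicit Arguments.
Unset Strict Implicit.
Unset Printing Implicit Defensive.

Import GRing.Theory.
Local Open Scope ring_scope.

(* Possibly infinite sets of ring elements, and ideals, are Prop predicates. *)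
Definition ideal_gen (R : comNzRingType) (S : R -> Prop) (f : R) : Prop :=
  exists r (c g : 'I_r -> R), (forall i, S (g i)) /\ f = \sum_i c i * g i.

Section MonomialIdeals.
Variables (K : fieldType) (N : nat).
Implicit Types (I J G : {mpoly K[N]} -> Prop).

(* For a monomial ideal J there is exactly one such G. *)
Definition minimal_generating_set J G : Prop :=
  [/\ forall g, G g -> exists u : 'X_{1..N}, g = 'X_[u],
      forall f, J f <-> ideal_gen G f
    & forall G', (forall g, G' g -> G g) ->
        (forall f, J f <-> ideal_gen G' f) -> forall g, G g -> G' g].

(* F_t = \bigoplus_j R(- fshift t j) is the module of row vectors of length
   frank t; a matrix M acts by v |-> v *m M.  The differential
   F_(t+1) -> F_t is fdiff t, and faug is the augmentation F_0 -> R. *)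
Record graded_free_data := GradedFreeData {
  frank : nat -> nat;
  fshift : forall t, 'I_(frank t) -> 'X_{1..N};
  fdiff : forall t, 'M[{mpoly K[N]}]_(frank t.+1, frank t);
  faug : 'cV[{mpoly K[N]}]_(frank 0) }.

(* f is a scalar multiple of X^(a - b), and is 0 if b does not divide a: the
   possible entries of a map R(-a) -> R(-b) of multidegree 0. *)
Definition homog_entry (a b : 'X_{1..N}) (f : {mpoly K[N]}) : Prop :=
  forall u, u \in msupp f -> (u + b)%MM = a.

Definition multigraded (F : graded_free_data) : Prop :=
  (forall j, homog_entry (fshift j) 0%MM (faug F j 0)) /\
  (forall t i j, homog_entry (fshift i) (fshift j) (fdiff F t i j)).

Definition finite_length (F : graded_free_data) : Prop :=
  exists l, forall t, (l < t)%N -> frank F t = 0%N.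

Definition resolves (F : graded_free_data) I : Prop :=
  [/\ forall f, I f <-> exists v : 'rV_(frank F 0), v *m faug F = f%:M,
      forall v : 'rV_(frank F 0), v *m faug F = 0 <-> exists w, v = w *m fdiff F 0
    & forall t (v : 'rV_(frank F t.+1)), v *m fdiff F t = 0 <-> exists w, v = w *m fdiff F t.+1].

(* The image of F_(t+1) lies in (X_1, ..., X_N) F_t. *)
Definition minimal_diff (F : graded_free_data) : Prop :=
  forall t i j, (fdiff F t i j)@_0%MM = 0.

Definition minimal_free_resolution (F : graded_free_data) I : Prop :=
  [/\ multigraded F, finite_length F, resolves F I & minimal_diff F].

(* A minimal multigraded free resolution of a monomial ideal exists and is
   unique up to isomorphism, so the choice of F does not matter. *)
Definition HS (t : nat) I (f : {mpoly K[N]}) : Prop :=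
  exists F, minimal_free_resolution F I /\
    ideal_gen (fun g => exists j : 'I_(frank F t), g = 'X_[fshift j]) f.

End MonomialIdeals.

Definition poset_ideal (T : finType) (le : rel T) (Q I : {set T}) : Prop :=
  [/\ I != set0, I \subset Q
    & forall x y, y \in I -> x \in Q -> le x y -> x \in I].

(* The elements 1, ..., n of [n] are represented by 0, ..., n-1 in 'I_n. *)
Section Hom.
Variables (d : Order.disp_t) (P : finPOrderType d) (m n : nat).
Variables (p : 'I_m -> P) (A : 'I_m -> {set 'I_n}).

Definition isotone (f : {ffun P -> 'I_n}) : bool :=
  [forall x, forall y, (x <= y)%O ==> (f x <= f y)%N].

Definition HomPA : {set {ffun P -> 'I_n}} :=
  [set f | isotone f && [forall i, f (p i) \in A i]].

Definition Hom_le : rel {ffun P -> 'I_n} :=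
  fun f g => [forall x, (f x <= g x)%N].

(* For non-empty B only: the values at set0 are 0 and n. *)
Definition set_max (B : {set 'I_n}) : nat := \max_(a in B) a.
Definition set_min (B : {set 'I_n}) : nat := \big[minn/n]_(a in B) (a : nat).

Variable K : fieldType.

Definition polyR := {mpoly K[#|{: P * 'I_n}|]}.

Definition Xvar (x : P) (a : 'I_n) : polyR := 'X_(enum_rank (x, a)).

Definition Umon (f : {ffun P -> 'I_n}) : polyR := \prod_(x : P) Xvar x (f x).

Definition Lideal (AA : {set {ffun P -> 'I_n}}) : polyR -> Prop :=
  ideal_gen (fun g : polyR => exists2 f, f \in AA & g = Umon f).

Definition XvarS (x : P) (B : {set 'I_n}) : polyR := \prod_(a in B) Xvar x a.

End Hom.

Arguments Lideal {d P n} K AA _.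

(* Main.v *)
Require Import Defs.
From HB Require Import structures.
From mathcomp Require Import all_boot all_order all_algebra.
From mathcomp Require Import mpoly.

(** The ideal [L(AA)] has an explicit cellular resolution whose cells are the
    products of simplices [B_1 x ... x B_m] of the statement.  A tuple
    [(B_i)] is encoded as the set of variables [S = {(p_i, a) | a in B_i}];
    the boundary of [S] is the signed sum of the sets [S \ {v}] that are again
    cells, with coefficient the variable [v], and a cell with [m + t] elements sits
    in homological degree [t] and has multidegree the product of its elements.
    The family of cells is convex for inclusion, so the boundary squares to
    zero because the boundary of a simplex does ([boundary_square]).

    Exactness can be tested one multidegree at a time ([exact_degreewise]),
    where it concerns the cells contained in a fixed set [W] of variables.  If
    there is such a cell, the fibrewise minimum [f0] of all of them is an element
    of [AA] ([bottom_map]).  A cell other than the graph of [f0] has a first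
    fibre, in the order of [p_1, ..., p_m], which is not [{f0 p_i}]; adding or
    removing [f0 p_i] in that fibre pairs off all the cells except the graph of
    [f0], and the pairing is triangular for the boundary
    ([lower_cells_triangular]).  A triangular pairing makes the complex exact by
    linear algebra alone ([matching_exact]); the unpaired vertex is matched with
    the generator of degree zero of the augmented complex.

    The matrix entries are multiples of single variables, so the resolution is
    minimal.  Since [HS] is defined through an arbitrary minimal resolution, the
    multidegrees must also be shown to be independent of that choice:
    comparison maps between two resolutions compose to a map homotopic to the
    identity, which for a minimal resolution is the identity modulo the variables
    ([shift_minimal]).  Finally, the monomials of the cells with [m + t]
    elements all have total degree [m + t], so none of them divides another and
    they are minimal generators ([equigenerated_minimal]). *)

Set Implicit Arguments.
Unset Strict Implicit.
Unset Printing Implicit Defensive.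

Import GRing.Theory.
Local Open Scope ring_scope.

(** * Multigraded maps between free modules *)

Section Homogeneous.
Variables (K : fieldType) (N : nat).
Implicit Types (a b c u : 'X_{1..N}) (f g : {mpoly K[N]}).

(** The multidegree [a] part of the coefficient [f] of a basis vector of
    multidegree [b]. *)
Definition hpart a b f : {mpoly K[N]} :=
  if (b <= a)%MM then f@_(a - b)%MM *: 'X_[a - b] else 0.

Lemma mcoeff_hpart a b f u :
  (hpart a b f)@_u = if (u + b)%MM == a then f@_u else 0.
Proof.
rewrite /hpart; case: ifP => [le_ba|nle].
  rewrite mcoeffZ mcoeffX -(inj_eq (@addIm _ b)) submK // eq_sym.
  by case: eqP => [<-|_]; rewrite ?addmK ?mulr1 ?mulr0.
rewrite mcoeff0; case: eqP => // eq_a.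
by rewrite -eq_a lem_addl in nle.
Qed.

Lemma hpart_sum (I : Type) (r : seq I) (Q : pred I) a b (F : I -> {mpoly K[N]}) :
  hpart a b (\sum_(i <- r | Q i) F i) = \sum_(i <- r | Q i) hpart a b (F i).
Proof.
apply/mpolyP => u; rewrite mcoeff_hpart !raddf_sum /=.
case: ifP => eq_a; first by apply: eq_bigr => i _; rewrite mcoeff_hpart eq_a.
by rewrite big1 // => i _; rewrite mcoeff_hpart eq_a.
Qed.

Lemma hpart_homog a b f : homog_entry a b (hpart a b f).
Proof.
move=> u; rewrite mcoeff_msupp mcoeff_hpart.
by case: (_ =P a) => // _; rewrite eqxx.
Qed.

Lemma hpart_id a b f : homog_entry a b f -> hpart a b f = f.
Proof.
move=> hf; apply/mpolyP => u; rewrite mcoeff_hpart.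
case: eqP => // ne; apply/esym/eqP; rewrite mcoeff_eq0.
by apply/negP => /hf.
Qed.

Lemma homog_entryP a b f : homog_entry a b f ->
  f = 0 \/ exists u x, a = (u + b)%MM /\ f = x *: 'X_[u].
Proof.
move/hpart_id; rewrite /hpart; case: ifP => [le_ba <-|_ <-]; last by left.
by right; exists (a - b)%MM, f@_(a - b)%MM; rewrite submK.
Qed.

Lemma mcoeffMX_le f a u :
  (f * 'X_[a])@_u = if (a <= u)%MM then f@_(u - a)%MM else 0.
Proof.
case: ifP => [le_au|nle]; first by rewrite -{1}(submK le_au) addmC mcoeffMX.
apply/eqP; rewrite mcoeff_eq0 (perm_mem (msuppMX f a)).
by apply/mapP => -[v _ eq_u]; rewrite eq_u lem_addr in nle.
Qed.

Lemma hpartM a b c f g :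
  homog_entry c b g -> hpart a b (f * g) = hpart a c f * g.
Proof.
case/homog_entryP => [->|[k [x [-> ->]]]].
  rewrite !mulr0; apply/mpolyP => u.
  by rewrite mcoeff_hpart mcoeff0; case: ifP.
apply/mpolyP => u; rewrite -!scalerAr mcoeff_hpart !mcoeffZ !mcoeffMX_le.
case: ifP => [eq_a|ne_a]; case: ifP => // le_ku.
  by rewrite mcoeff_hpart addmA submK // eq_a.
  by rewrite mcoeff_hpart addmA submK // ne_a mulr0.
by rewrite mulr0.
Qed.

Definition homog_mx r s (a : 'I_r -> 'X_{1..N}) (b : 'I_s -> 'X_{1..N})
    (M : 'M[{mpoly K[N]}]_(r, s)) : Prop :=
  forall i j, homog_entry (a i) (b j) (M i j).

(** A chain map between multigraded complexes is built from such lifts.  Taking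
    homogeneous parts of an arbitrary preimage of each row keeps the
    equation, because [hpart] commutes with multiplication by the homogeneous
    matrix [D]. *)
Lemma homog_lift r s q (a : 'I_r -> 'X_{1..N}) (b : 'I_s -> 'X_{1..N})
    (c : 'I_q -> 'X_{1..N}) (M : 'M[{mpoly K[N]}]_(r, s)) (D : 'M_(q, s)) :
  homog_mx a b M -> homog_mx c b D ->
  (forall i, exists w : 'rV_q, row i M = w *m D) ->
  exists2 W : 'M_(r, q), homog_mx a c W & M = W *m D.
Proof.
move=> hM hD /fin_all_exists [w wP].
exists (\matrix_(i, k) hpart (a i) (c k) (w i 0 k)).
  by move=> i k; rewrite mxE; apply: hpart_homog.
apply/matrixP => i j; rewrite mxE -[LHS](hpart_id (hM i j)).
have -> : M i j = row i M 0 j by rewrite mxE.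
rewrite wP mxE hpart_sum; apply: eq_bigr => k _.
by rewrite mxE (hpartM _ _ (hD k j)).
Qed.

Lemma mx_lift r s q (M : 'M[{mpoly K[N]}]_(r, s)) (D : 'M_(q, s)) :
  (forall i, exists w : 'rV_q, row i M = w *m D) ->
  exists W : 'M_(r, q), M = W *m D.
Proof.
move=> /fin_all_exists [w wP]; exists (\matrix_(i, k) w i 0 k).
apply/row_matrixP => i; rewrite wP row_mul; congr (_ *m D).
by apply/rowP => k; rewrite !mxE.
Qed.

End Homogeneous.

(** * The multidegrees of a minimal resolution *)

Section Uniqueness.
Variables (K : fieldType) (N : nat) (I : {mpoly K[N]} -> Prop).
Variables F G : graded_free_data K N.
Hypotheses (mF : multigraded F) (mG : multigraded G).
Hypotheses (rF : resolves F I) (rG : resolves G I) (minF : minimal_diff F).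

Let const0 r s (M : 'M[{mpoly K[N]}]_(r, s)) := forall i j, (M i j)@_0%MM = 0.

Let exact_lift (H : graded_free_data K N) (rH : resolves H I) t r
    (M : 'M_(r, frank H t.+1)) :
  M *m fdiff H t = 0 ->
  forall i, exists w : 'rV_(frank H t.+2), row i M = w *m fdiff H t.+1.
Proof.
case: rH => _ _ ex M0 i; apply/(ex t (row i M)).
by rewrite -row_mul M0 row0.
Qed.

Let exact_lift0 (H : graded_free_data K N) (rH : resolves H I) r
    (M : 'M_(r, frank H 0)) :
  M *m faug H = 0 ->
  forall i, exists w : 'rV_(frank H 1), row i M = w *m fdiff H 0.
Proof.
case: rH => _ ex _ M0 i; apply/(ex (row i M)).
by rewrite -row_mul M0 row0.
Qed.

Let fdiff2 (H : graded_free_data K N) (rH : resolves H I) t :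
  fdiff H t.+1 *m fdiff H t = 0.
Proof.
case: rH => _ _ ex; apply/row_matrixP => i; rewrite row_mul row0.
by apply/ex; exists (row i 1%:M); rewrite -row_mul mul1mx.
Qed.

Let fdiff_aug (H : graded_free_data K N) (rH : resolves H I) :
  fdiff H 0 *m faug H = 0.
Proof.
case: rH => _ ex _; apply/row_matrixP => i; rewrite row_mul row0.
by apply/ex; exists (row i 1%:M); rewrite -row_mul mul1mx.
Qed.

Let aug_lift (H H' : graded_free_data K N) (rH : resolves H I)
    (rH' : resolves H' I) :
  forall i, exists w : 'rV_(frank H' 0), row i (faug H) = w *m faug H'.
Proof.
case: rH rH' => gen _ _ [gen' _ _] i.
have /gen'[w wP] : I (faug H i 0).
  apply/gen; exists (row i 1%:M); rewrite -row_mul mul1mx.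
  by apply/matrixP => j k; rewrite !ord1 !mxE eqxx mulr1n.
exists w; rewrite wP; apply/matrixP => j k.
by rewrite !ord1 !mxE eqxx mulr1n.
Qed.

(** Degree [t] of chain maps [phi : F -> G] and [psi : G -> F] over the
    identity of [I], with [phi'], [psi'] their components of degree [t+1] and
    [h] the homotopy between the composite and the identity.  The remaining
    term [E] is the contribution of the homotopy in degree [t-1], of which only
    what the next degree needs is kept: this allows a plain induction on [t]
    instead of a recursive choice of all the maps. *)
Let comparison t := exists (phi : 'M_(frank F t, frank G t))
    (phi' : 'M_(frank F t.+1, frank G t.+1))
    (psi : 'M_(frank G t, frank F t)) (psi' : 'M_(frank G t.+1, frank F t.+1))
    (h : 'M_(frank F t, frank F t.+1)) (E : 'M_(frank F t)),
  [/\ homog_mx (@fshift _ _ F t) (@fshift _ _ G t) phi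
    /\ homog_mx (@fshift _ _ F t.+1) (@fshift _ _ G t.+1) phi',
      fdiff F t *m phi = phi' *m fdiff G t,
      fdiff G t *m psi = psi' *m fdiff F t,
      phi *m psi = 1%:M + h *m fdiff F t + E
    & fdiff F t *m E = 0 /\ const0 E].

Let homog_mul r s q (a : 'I_r -> 'X_{1..N}) (b : 'I_s -> 'X_{1..N})
    (c : 'I_q -> 'X_{1..N}) (M : 'M[{mpoly K[N]}]_(r, s)) (M' : 'M_(s, q)) :
  homog_mx a b M -> homog_mx b c M' -> homog_mx a c (M *m M').
Proof.
move=> hM hM' i k.
have <- : hpart (a i) (c k) ((M *m M') i k) = (M *m M') i k.
  rewrite mxE hpart_sum; apply: eq_bigr => j _.
  by rewrite (hpartM _ _ (hM' j k)) (hpart_id (hM i j)).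
exact: hpart_homog.
Qed.

Let comparison_all t : comparison t.
Proof.
case: mF mG => [hF0 hF] [hG0 hG].
elim: t => [|t [phi [phi' [psi [psi' [h [E [[hphi hphi'] cphi cpsi hh [dE E0]]]]]]]]].
  have [phi hphi aphi] := @homog_lift K N _ _ _ (@fshift _ _ F 0) (fun=> 0%MM)
    (@fshift _ _ G 0) (faug F) (faug G)
    (fun i j => eq_ind_r (fun j => homog_entry _ _ (faug F i j)) (hF0 i) (ord1 j))
    (fun i j => eq_ind_r (fun j => homog_entry _ _ (faug G i j)) (hG0 i) (ord1 j))
    (aug_lift rF rG).
  have [psi apsi] := mx_lift (aug_lift rG rF).
  have zphi : (fdiff F 0 *m phi) *m faug G = 0.
    by rewrite -mulmxA -aphi fdiff_aug.
  have zpsi : (fdiff G 0 *m psi) *m faug F = 0.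
    by rewrite -mulmxA -apsi fdiff_aug.
  have [phi' hphi' cphi] :=
    homog_lift (homog_mul (hF 0) hphi) (hG 0) (exact_lift0 rG zphi).
  have [psi' cpsi] := mx_lift (exact_lift0 rF zpsi).
  (* In degree 0 the augmentation of [F] replaces the previous differential. *)
  have zh : (phi *m psi - 1%:M) *m faug F = 0.
    by rewrite mulmxBl -mulmxA -apsi -aphi mul1mx subrr.
  have [h hP] := mx_lift (exact_lift0 rF zh).
  exists phi, phi', psi, psi', h, 0; split => //.
    by rewrite addr0 -hP addrC subrK.
  by split; [rewrite mulmx0 | move=> i j; rewrite mxE mcoeff0].
have zphi : (fdiff F t.+1 *m phi') *m fdiff G t = 0.
  by rewrite -mulmxA -cphi mulmxA fdiff2 // mul0mx.
have zpsi : (fdiff G t.+1 *m psi') *m fdiff F t = 0.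
  by rewrite -mulmxA -cpsi mulmxA fdiff2 // mul0mx.
have [phi'' hphi'' cphi'] :=
  homog_lift (homog_mul (hF t.+1) hphi') (hG t.+1) (exact_lift rG zphi).
have [psi'' cpsi'] := mx_lift (exact_lift rF zpsi).
have zh : (phi' *m psi' - 1%:M - fdiff F t *m h) *m fdiff F t = 0.
  have e : phi' *m psi' *m fdiff F t = fdiff F t + fdiff F t *m h *m fdiff F t.
    rewrite -mulmxA -cpsi mulmxA -cphi -mulmxA hh !mulmxDr.
    by rewrite mulmx1 dE addr0 mulmxA.
  by rewrite !mulmxBl e mul1mx addrAC addrK subrr.
have [h' hP'] := mx_lift (exact_lift rF zh).
exists phi', phi'', psi', psi'', h', (fdiff F t *m h); split => //.
  by rewrite -hP' -addrA subrK addrC subrK.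
split; first by rewrite mulmxA fdiff2 // mul0mx.
move=> i j; rewrite mxE raddf_sum big1 // => k _ /=.
by rewrite -[mcoeff 0 _]/(mcoeff 0%MM _) rmorphM /= minF mul0r.
Qed.

(** Modulo the variables the comparison map [F -> G -> F] is the identity, so
    every row of [F -> G] has an entry with a non-zero constant term; such an
    entry joins basis vectors of the same multidegree. *)
Lemma shift_minimal t (j : 'I_(frank F t)) :
  exists k : 'I_(frank G t), fshift j = fshift k.
Proof.
have [phi [_ [psi [_ [h [E [[hphi _] _ _ hh [_ E0]]]]]]]] := comparison_all t.
have : ((phi *m psi) j j)@_0%MM = 1.
  rewrite hh !mxE eqxx mulr1n !mcoeffD mcoeff1 eqxx E0 addr0 raddf_sum big1 ?addr0 //.
  by move=> k _ /=; rewrite rmorphM /= minF mulr0.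
rewrite mxE raddf_sum /= => sum1.
have [k /eqP nz | z] := pickP (fun k => (phi j k)@_0%MM != 0).
  exists k; apply/esym; rewrite -[LHS]add0m; apply: hphi.
  by rewrite mcoeff_msupp; apply/eqP.
move/eqP: sum1; rewrite big1 ?(eq_sym 0) ?oner_eq0 // => k _.
by rewrite rmorphM /= (eqP (negbFE (z k))) mul0r.
Qed.

End Uniqueness.
(** * Exactness degree by degree *)

Section DegreewiseExactness.
Variables (K : fieldType) (N : nat).
Implicit Types a b c u : 'X_{1..N}.

(** The homogeneous matrix with scalar part [M].  The truncated quotient
    [c i - b j] is meaningful only where [b j] divides [c i], whence
    [degree_compatible] below. *)
Definition hom_mx r s (c : 'I_r -> 'X_{1..N}) (b : 'I_s -> 'X_{1..N})
    (M : 'M[K]_(r, s)) : 'M[{mpoly K[N]}]_(r, s) :=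
  \matrix_(i, j) (M i j *: 'X_[c i - b j]).

Definition degree_compatible r s (c : 'I_r -> 'X_{1..N})
    (b : 'I_s -> 'X_{1..N}) (M : 'M[K]_(r, s)) : Prop :=
  forall i j, M i j != 0 -> (b j <= c i)%MM.

Lemma hom_mx_homog r s (c : 'I_r -> 'X_{1..N}) (b : 'I_s -> 'X_{1..N}) M :
  degree_compatible c b M -> homog_mx c b (hom_mx c b M).
Proof.
move=> hM i j u; rewrite mxE mcoeff_msupp mcoeffZ mcoeffX mulf_eq0 negb_or.
case/andP => /hM le_bc; case: (_ =P u) => [<- _|]; last by rewrite eqxx.
by rewrite submK.
Qed.

Lemma hom_mxM r s q (c : 'I_r -> 'X_{1..N}) (b : 'I_s -> 'X_{1..N})
    (a : 'I_q -> 'X_{1..N}) M M' :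
  degree_compatible c b M -> degree_compatible b a M' ->
  hom_mx c b M *m hom_mx b a M' = hom_mx c a (M *m M').
Proof.
move=> hM hM'; apply/matrixP => i k; rewrite !mxE scaler_suml.
apply: eq_bigr => j _; rewrite !mxE -scalerAl -scalerAr scalerA -mpolyXD.
have [-> | /hM le_bc] := eqVneq (M i j) 0; first by rewrite mul0r !scale0r.
have [-> | /hM' le_ab] := eqVneq (M' j k) 0; first by rewrite mulr0 !scale0r.
by rewrite addmBA // submK.
Qed.

Lemma hom_mx_eq0 r s (c : 'I_r -> 'X_{1..N}) (b : 'I_s -> 'X_{1..N}) M :
  hom_mx c b M = 0 -> M = 0.
Proof.
move=> /matrixP z; apply/matrixP => i j; move: (z i j); rewrite !mxE.
by move/(congr1 (mcoeff (c i - b j))); rewrite mcoeffZ mcoeffX eqxx mulr1 mcoeff0.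
Qed.

Lemma sum_hpart (s : seq 'X_{1..N}) b (f : {mpoly K[N]}) :
  uniq s -> (forall u, u \in msupp f -> (u + b)%MM \in s) ->
  \sum_(a <- s) hpart a b f = f.
Proof.
move=> us hs; apply/mpolyP => u; rewrite raddf_sum /=.
rewrite (eq_bigr (fun a => if (u + b)%MM == a then f@_u else 0)); last first.
  by move=> a _; rewrite mcoeff_hpart.
rewrite -big_mkcond /=; have [u_f | /memN_msupp_eq0 ->] := boolP (u \in msupp f).
  rewrite (eq_bigl (pred1 (u + b)%MM)); last by move=> a; rewrite eq_sym.
  by rewrite -big_filter filter_pred1_uniq ?hs // big_seq1.
by rewrite big1.
Qed.

(** A complex of homogeneous matrices splits as a direct sum of complexes of
    vector spaces, one for each multidegree [a], spanned by the basis vectors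
    whose multidegree divides [a]. *)
Lemma exact_degreewise r2 r1 r0 (c2 : 'I_r2 -> 'X_{1..N})
    (c1 : 'I_r1 -> 'X_{1..N}) (c0 : 'I_r0 -> 'X_{1..N}) M2 M1 :
  degree_compatible c2 c1 M2 -> degree_compatible c1 c0 M1 -> M2 *m M1 = 0 ->
  (forall a (x : 'rV_r1), (forall j, x 0 j != 0 -> (c1 j <= a)%MM) ->
     x *m M1 = 0 ->
     exists2 y : 'rV_r2, (forall i, y 0 i != 0 -> (c2 i <= a)%MM) & x = y *m M2) ->
  forall v : 'rV_r1, v *m hom_mx c1 c0 M1 = 0 <->
    exists w, v = w *m hom_mx c2 c1 M2.
Proof.
move=> h2 h1 M0 ex v; split=> [v0 | [w ->]]; last first.
  rewrite -mulmxA hom_mxM // M0; apply/matrixP => i j.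
  by rewrite mxE [RHS]mxE big1 // => k _; rewrite !mxE scale0r mulr0.
(* It suffices to lift the homogeneous components [vp a] of [v], whose scalar
   part [x] is a cycle of the complex of vector spaces of degree [a]. *)
pose vp a := \row_j hpart a (c1 j) (v 0 j).
have vp_im a : exists w, vp a = w *m hom_mx c2 c1 M2.
  pose x : 'rV[K]_r1 :=
    \row_j (if (c1 j <= a)%MM then (v 0 j)@_(a - c1 j) else 0).
  have hx j : x 0 j != 0 -> (c1 j <= a)%MM by rewrite mxE; case: ifP; rewrite ?eqxx.
  have vpE : vp a = hom_mx (fun=> a) c1 x.
    apply/rowP => j; rewrite !mxE /hpart.
    by case: ifP; rewrite ?scale0r.
  have /ex [|y hy xE] := hx.
    apply: (@hom_mx_eq0 _ _ (fun=> a) c0); rewrite -(hom_mxM _ h1) -?vpE; last first.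
      by move=> i j; rewrite ord1; apply: hx.
    have hD := hom_mx_homog h1; apply/rowP => k; rewrite mxE [RHS]mxE.
    transitivity (hpart a (c0 k) ((v *m hom_mx c1 c0 M1) 0 k)).
      rewrite mxE hpart_sum; apply: eq_bigr => j _.
      by rewrite mxE (hpartM _ _ (hD j k)).
    rewrite v0 mxE; apply/mpolyP => u.
    by rewrite mcoeff_hpart mcoeff0; case: ifP.
  exists (hom_mx (fun=> a) c2 y); rewrite hom_mxM -?xE //.
  by move=> i j; rewrite ord1; apply: hy.
pose s := undup (flatten
  [seq [seq (u + c1 j)%MM | u <- msupp (v 0 j)] | j <- enum 'I_r1]).
have <- : \sum_(a <- s) vp a = v.
  apply/rowP => j; rewrite summxE -[RHS](@sum_hpart s (c1 j)) ?undup_uniq //.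
    by apply: eq_bigr => a _; rewrite mxE.
  move=> u u_v; rewrite mem_undup; apply/flattenP.
  exists [seq (u + c1 j)%MM | u <- msupp (v 0 j)]; last exact: map_f.
  by apply/mapP; exists j; rewrite ?mem_enum.
elim: s => [|a s [w IH]]; first by exists 0; rewrite big_nil mul0mx.
have [wa e] := vp_im a.
by exists (wa + w); rewrite big_cons IH e mulmxDl.
Qed.

(** [exact_degreewise] with the bases of the two upper modules indexed by sets of
    cells, so that exactness becomes a property of functions on cells and the
    enumeration of the bases disappears.  The lowest module keeps an arbitrary
    basis, which covers both a third set of cells and the ground ring. *)
Lemma cells_exact (C2 C1 : finType) (X2 : {set C2}) (X1 : {set C1}) r0
    (g2 : C2 -> 'X_{1..N}) (g1 : C1 -> 'X_{1..N}) (g0 : 'I_r0 -> 'X_{1..N})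
    (d2 : C2 -> C1 -> K) (d1 : C1 -> 'I_r0 -> K) :
  (forall U S, d2 U S != 0 -> (g1 S <= g2 U)%MM) ->
  (forall S k, d1 S k != 0 -> (g0 k <= g1 S)%MM) ->
  (forall U k, U \in X2 -> \sum_(S in X1) d2 U S * d1 S k = 0) ->
  (forall a (x : C1 -> K),
     (forall k, \sum_(S in X1 | (g1 S <= a)%MM) x S * d1 S k = 0) ->
     exists y : C2 -> K, forall S, S \in X1 -> (g1 S <= a)%MM ->
       x S = \sum_(U in X2 | (g2 U <= a)%MM) y U * d2 U S) ->
  forall v : 'rV_#|X1|,
    v *m hom_mx (fun i => g1 (enum_val i)) g0 (\matrix_(i, k) d1 (enum_val i) k) = 0
    <-> exists w : 'rV_#|X2|, v = w *m
      hom_mx (fun i => g2 (enum_val i)) (fun j => g1 (enum_val j))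
             (\matrix_(i, j) d2 (enum_val i) (enum_val j)).
Proof.
move=> h2 h1 dd ex; apply: exact_degreewise.
- by move=> i j; rewrite mxE; apply: h2.
- by move=> i j; rewrite mxE; apply: h1.
- apply/matrixP => i k; rewrite !mxE -[RHS](dd (enum_val i) k (enum_valP i)).
  rewrite [RHS]big_enum_val; apply: eq_bigr => j _ /=.
  by rewrite !mxE.
move=> a x hx x0.
pose xx S : K := \sum_(j | enum_val j == S) x 0 j.
have xxE j : xx (enum_val j) = x 0 j.
  by rewrite /xx (eq_bigl (pred1 j)) ?big_pred1_eq // => i; rewrite (inj_eq enum_val_inj).
have [k | y yP] := ex a xx.
  transitivity ((x *m (\matrix_(i, k) d1 (enum_val i) k)) 0 k); last by rewrite x0 mxE.
  rewrite big_mkcondr big_enum_val mxE; apply: eq_bigr => j _ /=.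
  rewrite mxE xxE; case: ifP => // /negbT nle.
  by have [-> | /hx] := eqVneq (x 0 j) 0; rewrite ?mul0r // (negPf nle).
exists (\row_i if (g2 (enum_val i) <= a)%MM then y (enum_val i) else 0).
  by move=> i; rewrite mxE; case: ifP; rewrite ?eqxx.
apply/rowP => j; rewrite -xxE mxE.
transitivity (\sum_(U in X2 | (g2 U <= a)%MM) y U * d2 U (enum_val j)).
  have [le_a|nle] := boolP (g1 (enum_val j) <= a)%MM; first by rewrite yP ?enum_valP.
  rewrite xxE big1 => [|U /andP[_ le_Ua]].
    by apply/eqP; apply/negPn/negP => /hx; apply/negP.
  have [-> | /h2 le_jU] := eqVneq (d2 U (enum_val j)) 0; first by rewrite mulr0.
  by rewrite (lepm_trans le_jU le_Ua) in nle.
rewrite big_mkcondr big_enum_val; apply: eq_bigr => i _ /=.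
by rewrite !mxE; case: ifP => //; rewrite mul0r.
Qed.

End DegreewiseExactness.

(** * Exactness from a triangular matching of cells *)

Section Matching.
Variable K : fieldType.

Definition triangular (C : finType) (L : {set C}) (M : C -> C -> K)
    (h : C -> nat) : Prop :=
  (forall S, S \in L -> M S S != 0) /\
  (forall S S', S \in L -> S' \in L -> S' != S -> M S S' != 0 -> (h S < h S')%N).

(** The relation [M S S' != 0] strictly increases [h] off the diagonal, so at a
    point of the support of [w] where [h] is minimal only the diagonal term
    survives. *)
Lemma triangular_inj (C : finType) (L : {set C}) M h (w : C -> K) :
  triangular L M h ->
  (forall S', S' \in L -> \sum_(S in L) w S * M S S' = 0) ->
  forall S, S \in L -> w S = 0.
Proof.
case=> dg tri w0 S0 S0L; apply/eqP/negPn/negP => wS0.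
have [|S /andP[SL wS] minS] := @arg_minnP _ S0 [pred S in L | w S != 0] h.
  by rewrite /= S0L.
move/eqP: (w0 S SL); rewrite (bigD1 S) //= big1 ?addr0 => [|T /andP[TL TS]].
  by rewrite mulf_eq0 (negPf wS) (negPf (dg S SL)).
apply/eqP; rewrite mulf_eq0; apply/orP.
have [_ | wT] := eqVneq (w T) 0; first by left.
right; apply/negPn/negP; rewrite eq_sym in TS => /(tri T S TL SL TS).
by rewrite ltnNge minS //= TL.
Qed.

(** The matrix of [M] on [L] is square, so it is invertible as soon as it is
    injective. *)
Lemma triangular_surj (C : finType) (L : {set C}) M h (x : C -> K) :
  triangular L M h ->
  exists w : C -> K, forall S', S' \in L -> x S' = \sum_(S in L) w S * M S S'.
Proof.
move=> tri; pose B := \matrix_(i < #|L|, j < #|L|) M (enum_val i) (enum_val j).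
pose ext (v : 'rV_#|L|) S : K := \sum_(j | enum_val j == S) v 0 j.
have extE v j : ext v (enum_val j) = v 0 j.
  by rewrite /ext (eq_bigl (pred1 j)) ?big_pred1_eq // => i; rewrite (inj_eq enum_val_inj).
have extM v j : \sum_(S in L) ext v S * M S (enum_val j) = (v *m B) 0 j.
  by rewrite big_enum_val mxE; apply: eq_bigr => i _; rewrite extE mxE.
have uB : B \in unitmx.
  rewrite -row_free_unit; apply: inj_row_free => v v0.
  apply/rowP => j; rewrite mxE -extE.
  apply: (triangular_inj tri) (enum_valP j) => S' S'L.
  by rewrite -(enum_rankK_in S'L S'L) extM v0 mxE.
exists (ext ((\row_j x (enum_val j)) *m invmx B)) => S' S'L.
by rewrite -(enum_rankK_in S'L S'L) extM mulmxKV // mxE.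
Qed.

(** The algebra of an acyclic matching.  The cells of [X1] are split into the
    lower partners [L1] and the upper partners [mu0 L0].  Triangularity of
    [d2 (mu1 S) S'] lets a boundary clear the coefficients of a cycle on [L1];
    triangularity of [d1 (mu0 T) T'] forces the remaining cycle to vanish. *)
Lemma matching_exact (C2 C1 C0 : finType) (X2 : {set C2}) (X1 : {set C1})
    (X0 : {set C0}) (d2 : C2 -> C1 -> K) (d1 : C1 -> C0 -> K)
    (L1 : {set C1}) (L0 : {set C0}) (mu1 : C1 -> C2) (mu0 : C0 -> C1) h1 h0 :
  L1 \subset X1 -> {in L1, forall S, mu1 S \in X2} ->
  L0 \subset X0 -> {in L0, forall T, mu0 T \in X1} ->
  (forall S, S \in X1 -> S \in L1 \/ exists2 T, T \in L0 & S = mu0 T) ->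
  triangular L1 (fun S S' => d2 (mu1 S) S') h1 ->
  triangular L0 (fun T T' => d1 (mu0 T) T') h0 ->
  (forall U T, U \in X2 -> T \in X0 -> \sum_(S in X1) d2 U S * d1 S T = 0) ->
  forall x : C1 -> K, (forall T, T \in X0 -> \sum_(S in X1) x S * d1 S T = 0) ->
  exists y : C2 -> K, forall S, S \in X1 -> x S = \sum_(U in X2) y U * d2 U S.
Proof.
move=> sL1 mL1 sL0 mL0 cov tri1 tri0 dd x x0.
have [w wP] := triangular_surj x tri1.
pose y U := \sum_(S in L1 | mu1 S == U) w S; exists y.
pose z S := x S - \sum_(U in X2) y U * d2 U S.
suff z0 : forall S, S \in X1 -> z S = 0.
  by move=> S SX; apply: subr0_eq; apply: z0.
have zL1 S : S \in L1 -> z S = 0.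
  move=> SL; rewrite /z wP //; apply/eqP; rewrite subr_eq0; apply/eqP.
  rewrite (partition_big mu1 (mem X2)) /=; last by move=> S' /mL1.
  apply: eq_bigr => U _; rewrite /y mulr_suml; apply: eq_bigr => S' /andP[_ /eqP <-] //.
have z_cycle T : T \in X0 -> \sum_(S in X1) z S * d1 S T = 0.
  move=> TX; rewrite (eq_bigr (fun S => x S * d1 S T -
    \sum_(U in X2) y U * (d2 U S * d1 S T))) => [|S _].
    rewrite sumrB x0 // exchange_big /= big1 ?subr0 // => U UX.
    by rewrite -mulr_sumr dd // mulr0.
  by rewrite mulrBl mulr_suml; congr (_ - _); apply: eq_bigr => U _; rewrite mulrA.
have mu0_inj : {in L0 &, injective mu0}.
  case: tri0 => dg tri T T' TL TL' e; apply/eqP/negPn/negP => ne.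
  have l1 : (h0 T < h0 T')%N by apply: (tri T T') => //; [rewrite eq_sym | rewrite e dg].
  have l2 : (h0 T' < h0 T)%N by apply: (tri T' T) => //; rewrite -e dg.
  by have := ltn_trans l1 l2; rewrite ltnn.
have zmu T : T \in L0 -> z (mu0 T) = 0.
  apply: (triangular_inj (w := z \o mu0) tri0) => T' T'L.
  apply: etrans (z_cycle T' (subsetP sL0 _ T'L)).
  transitivity (\sum_(S in mu0 @: L0) z S * d1 S T').
    by rewrite (big_imset _ mu0_inj).
  rewrite [RHS](bigID (mem (mu0 @: L0))) /= [X in _ + X]big1 ?addr0.
    apply: eq_bigl => S; rewrite andbC; case: imsetP => // -[R RL ->].
    by rewrite mL0.
  move=> S /andP[SX nim]; case: (cov S SX) => [/zL1 -> | [R RL e]].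
    by rewrite mul0r.
  by case/negP: nim; rewrite e imset_f.
by move=> S SX; case: (cov S SX) => [/zL1 // | [T TL ->]]; apply: zmu.
Qed.

End Matching.
(** * Complexes of sets of variables *)

Section SimplicialSigns.
Variables (K : fieldType) (V : finType) (lt : rel V).
Hypothesis lt_tournament : forall x y, x != y -> lt x y = ~~ lt y x.
Implicit Types S T U : {set V}.

(** The usual simplicial signs.  Any tournament [lt] will do: the signs of
    two successive removals only depend on how the two elements compare. *)
Definition face_sign U x : K := (-1) ^+ #|[set y in U | lt y x]|.

(** The sum has at most one term; this form makes the boundary of the full
    simplex a sum over elements of [U], see [incidence_sum]. *)
Definition incidence U S : K := \sum_(x in U | U :\ x == S) face_sign U x.

Lemma setD1_inj U x y : x \in U -> U :\ x = U :\ y -> x = y.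
Proof.
move=> xU /setP/(_ x); rewrite !inE eqxx xU andbT /=.
by case: eqVneq.
Qed.

Lemma incidence_face U x : x \in U -> incidence U (U :\ x) = face_sign U x.
Proof.
move=> xU; rewrite /incidence (big_pred1 x) // => y; rewrite /= andbC.
apply/andP/eqP => [[/eqP e _] | ->]; last by rewrite eqxx.
exact/esym/(setD1_inj xU).
Qed.

Lemma incidence_face_neq0 U x : x \in U -> incidence U (U :\ x) != 0.
Proof. by move=> xU; rewrite incidence_face // signr_eq0. Qed.

Lemma incidence_neq0P U S : incidence U S != 0 -> exists2 x, x \in U & S = U :\ x.
Proof.
move=> nz; have [x /andP[xU /eqP <-] | no] := pickP (fun x => (x \in U) && (U :\ x == S)).
  by exists x.
by rewrite /incidence big_pred0 ?eqxx in nz.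
Qed.

Lemma incidence_sum U (F : {set V} -> K) :
  \sum_S incidence U S * F S = \sum_(x in U) face_sign U x * F (U :\ x).
Proof.
rewrite [RHS](partition_big (fun x => U :\ x) predT) //=.
apply: eq_bigr => S _; rewrite mulr_suml.
by apply: eq_bigr => x /andP[_ /eqP ->].
Qed.

Lemma face_sign_swap U x y : x \in U -> y \in U -> x != y ->
  face_sign U x * face_sign (U :\ x) y + face_sign U y * face_sign (U :\ y) x = 0.
Proof.
wlog lt_xy : x y / lt x y => [wl xU yU ne | xU yU ne].
  have [l | l] := boolP (lt x y); first exact: wl.
  rewrite addrC; apply: wl => //; last by rewrite eq_sym.
  by rewrite lt_tournament // eq_sym.
have nlt_yx : ~~ lt y x by rewrite -lt_tournament.
have -> : face_sign (U :\ y) x = face_sign U x.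
  rewrite /face_sign; congr (_ ^+ #|pred_of_set _|); apply/setP => z; rewrite !inE.
  by case: (eqVneq z y) => [-> | _] //=; rewrite (negPf nlt_yx) andbF.
have -> : face_sign U y = - face_sign (U :\ x) y.
  rewrite /face_sign (cardsD1 x) inE xU lt_xy exprS mulN1r; congr (- (_ ^+ #|pred_of_set _|)).
  by apply/setP => z; rewrite !inE andbA.
by rewrite mulNr mulrC subrr.
Qed.

(** The two ways of removing two elements cancel; the ordered pairs are
    split by [lt] so that the cancellation is also valid in characteristic 2. *)
Lemma incidence_square U T : \sum_S incidence U S * incidence S T = 0.
Proof.
rewrite incidence_sum.
pose Q (p : V * V) := [&& p.1 \in U, p.2 \in U :\ p.1 & U :\ p.1 :\ p.2 == T].
pose f (p : V * V) := face_sign U p.1 * face_sign (U :\ p.1) p.2.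
transitivity (\sum_(p | Q p) f p).
  rewrite /Q -(pair_big_dep (mem U)
    (fun x y => (y \in U :\ x) && (U :\ x :\ y == T)) (fun x y => f (x, y))) /=.
  by apply: eq_bigr => x _; rewrite mulr_sumr.
rewrite (bigID (fun p => lt p.1 p.2)) /=.
pose sw (p : V * V) := (p.2, p.1).
have swK : involutive sw by case.
rewrite [X in _ + X](reindex_inj (inv_inj swK)) /=.
have Qsw p : Q (sw p) = Q p.
  case: p => x y; rewrite /Q /= !inE setDDl [in RHS]setDDl [[set y] :|: _]setUC.
  rewrite (eq_sym x); case: (x \in U) => //=; case: (y \in U); rewrite ?andbF //.
have Qne p : Q p -> p.1 != p.2.
  by case: p => x y /and3P[_]; rewrite !inE eq_sym => /andP[].
rewrite [X in _ + X](eq_bigl (fun p => Q p && lt p.1 p.2)) => [|p]; last first.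
  rewrite Qsw; case Qp: (Q p) => //=.
  by rewrite (lt_tournament (Qne _ Qp)).
rewrite -big_split big1 //= => p /andP[Qp _].
case/and3P: (Qp) => xU; rewrite !inE => /andP[_ yU] _.
exact: face_sign_swap xU yU (Qne _ Qp).
Qed.

End SimplicialSigns.

Section SquarefreeMonomials.
Variable V : finType.
Implicit Types S T U : {set V}.

Definition set_mnm S : 'X_{1..#|{: V}|} := [multinom (enum_val i \in S : nat) | i < #|{: V}|].

Definition mnm_support (a : 'X_{1..#|{: V}|}) : {set V} := [set v | a (enum_rank v) != 0%N].

Lemma set_mnm_le S a : (set_mnm S <= a)%MM = (S \subset mnm_support a).
Proof.
apply/mnm_lepP/subsetP => [le v vS | sub i].
  by move: (le (enum_rank v)); rewrite mnmE enum_rankK vS inE lt0n.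
rewrite mnmE; case: (boolP (_ \in S)) => // /sub.
by rewrite inE enum_valK lt0n.
Qed.

Lemma mnm_support_set S : mnm_support (set_mnm S) = S.
Proof. by apply/setP => v; rewrite inE mnmE enum_rankK; case: (v \in S). Qed.

Lemma set_mnmD1 U x : x \in U ->
  set_mnm U = (set_mnm (U :\ x) + U_(enum_rank x))%MM.
Proof.
move=> xU; apply/mnmP => i; rewrite mnmDE mnm1E !mnmE !inE.
have -> : (enum_rank x == i) = (enum_val i == x).
  by rewrite -{1}(enum_valK i) (inj_eq enum_rank_inj) eq_sym.
by case: (eqVneq (enum_val i) x) => [-> | _]; rewrite ?xU ?addn0.
Qed.

Lemma mdeg_set_mnm S : mdeg (set_mnm S) = #|S|.
Proof.
rewrite mdegE -sum1_card [RHS]big_mkcond [RHS](reindex _ (onW_bij _ (enum_val_bij V))).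
by apply: eq_big => // i _; rewrite mnmE; case: (_ \in S).
Qed.

End SquarefreeMonomials.

Section CellComplex.
Variables (K : fieldType) (V : finType) (lt : rel V).
Hypothesis lt_tournament : forall x y, x != y -> lt x y = ~~ lt y x.
Variables (fam : {set {set V}}) (m : nat).
Implicit Types S T U W : {set V}.

Let inc := incidence K lt.

Definition cells t : {set {set V}} := [set S in fam | #|S| == (m + t)%N].

Definition cells_in W t : {set {set V}} := [set S in cells t | S \subset W].

Lemma mem_cells_in W t S :
  (S \in cells_in W t) = [&& S \in fam, #|S| == (m + t)%N & S \subset W].
Proof. by rewrite 2!inE andbA. Qed.

(** The differential is the relative simplicial boundary, homogenized: faces of a
    cell that leave the family [fam] are dropped.  The number [m] is the size of
    the vertices, the cells of dimension 0. *)
Definition cell_complex : graded_free_data K #|{: V}| :=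
  @GradedFreeData K #|{: V}| (fun t => #|cells t|)
    (fun t i => set_mnm (enum_val i))
    (fun t => hom_mx (fun i => set_mnm (enum_val i)) (fun j => set_mnm (enum_val j))
       (\matrix_(i, j) inc (enum_val i) (enum_val j)))
    (hom_mx (fun i => set_mnm (enum_val i)) (fun=> 0%MM) (\matrix_(i, j) 1)).

Let inc_compat U S : inc U S != 0 -> (set_mnm S <= set_mnm U)%MM.
Proof.
move/incidence_neq0P => [x _ ->].
by rewrite set_mnm_le mnm_support_set subD1set.
Qed.

Hypothesis fam_convex : forall T S U,
  T \in fam -> U \in fam -> T \subset S -> S \subset U -> S \in fam.

(** Removing two elements passes through sets of the family only, by convexity,
    so the boundary of a boundary is that of the full simplex. *)
Lemma boundary_square t U T : U \in cells t.+2 -> T \in cells t ->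
  \sum_(S in cells t.+1) inc U S * inc S T = 0.
Proof.
rewrite !inE => /andP[Uf /eqP cU] /andP[Tf /eqP cT].
rewrite -[RHS](incidence_square K lt_tournament U T) big_mkcond /=.
apply: eq_bigr => S _; case: ifP => // /negP nS.
apply/esym/eqP; apply: contraT; rewrite mulf_eq0 negb_or => /andP[].
move=> /incidence_neq0P[x xU eS] /incidence_neq0P[y yS eT]; case: nS.
rewrite inE (fam_convex Tf Uf) ?eS ?eT ?subD1set //=.
  by move: cU; rewrite (cardsD1 x) xU addnS add1n => -[->].
by rewrite -eS subD1set.
Qed.

(** The faces of a set inside [W] are inside [W], so boundaries may be computed
    without mentioning [W]. *)
Lemma sum_faces_in W t U (F : {set V} -> K) : U \subset W ->
  \sum_(S in cells_in W t) inc U S * F S = \sum_(S in cells t) inc U S * F S.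
Proof.
move=> UW; rewrite [LHS]big_mkcond [RHS]big_mkcond; apply: eq_bigr => S _.
rewrite inE; case: (S \in cells t) => //=; case: ifP => // nSW.
have [-> | nz] := eqVneq (inc U S) 0; first by rewrite mul0r.
have [x _ eS] := incidence_neq0P nz.
by rewrite eS (subset_trans (subD1set _ _) UW) in nSW.
Qed.

Hypothesis augmentation : forall U, U \in cells 1 -> \sum_(S in cells 0) inc U S = 0.

Hypothesis acyclic : forall W t (x : {set V} -> K),
  (forall T, T \in cells_in W t -> \sum_(S in cells_in W t.+1) x S * inc S T = 0) ->
  exists y : {set V} -> K, forall S, S \in cells_in W t.+1 ->
    x S = \sum_(U in cells_in W t.+2) y U * inc U S.

Hypothesis acyclic0 : forall W (x : {set V} -> K),
  \sum_(S in cells_in W 0) x S = 0 ->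
  exists y : {set V} -> K, forall S, S \in cells_in W 0 ->
    x S = \sum_(U in cells_in W 1) y U * inc U S.

Let cells_inE W t S : (S \in cells_in W t) = (S \in cells t) && (S \subset W).
Proof. by rewrite inE. Qed.

Let sum_cells_in a t (F : {set V} -> K) :
  \sum_(S in cells t | (set_mnm S <= a)%MM) F S =
  \sum_(S in cells_in (mnm_support a) t) F S.
Proof. by apply: eq_bigl => S; rewrite cells_inE set_mnm_le. Qed.

Lemma cell_complex_resolves :
  resolves cell_complex
    (ideal_gen (fun g => exists2 S, S \in cells 0 & g = 'X_[set_mnm S])).
Proof.
split.
- move=> f; split=> [[r [c [g [gP ->]]]] | [v vP]].
    have {gP} [S SX SP] := fin_all_exists2 gP.
    exists (\row_i \sum_(j | S j == enum_val i) c j).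
    apply/matrixP => i0 j0; rewrite !ord1 !mxE eqxx mulr1n.
    under eq_bigr => i _ do rewrite !mxE scale1r subm0.
    rewrite -(big_enum_val (fun T => (\sum_(j | S j == T) c j) * 'X_[set_mnm T])) /=.
    rewrite [RHS](partition_big S (mem (cells 0))) //=.
    apply: eq_bigr => T _; rewrite mulr_suml; apply: eq_bigr => j /eqP <-.
    by rewrite SP.
  exists #|cells 0|, (fun i => v 0 i), (fun i => 'X_[set_mnm (enum_val i)]); split.
    by move=> i; exists (enum_val i); rewrite ?enum_valP.
  transitivity ((v *m faug cell_complex) 0 0); first by rewrite vP mxE eqxx mulr1n.
  by rewrite mxE; apply: eq_bigr => i _; rewrite !mxE scale1r subm0.
- apply: (@cells_exact K _ _ _ (cells 1) (cells 0) 1 (@set_mnm V) (@set_mnm V)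
    (fun=> 0%MM) inc (fun _ _ => 1)) => //.
    by move=> S k _; apply/mnm_lepP => i; rewrite mnm0E.
    by move=> U k /augmentation {2}<-; apply: eq_bigr => S _; rewrite mulr1.
  move=> a x /(_ 0); rewrite sum_cells_in => x0.
  have [|y yP] := @acyclic0 (mnm_support a) x.
    by rewrite -[RHS]x0; apply: eq_bigr => S _; rewrite mulr1.
  exists y => S SX; rewrite set_mnm_le sum_cells_in => SW.
  by apply: yP; rewrite cells_inE SX.
move=> t.
apply: (@cells_exact K _ _ _ (cells t.+2) (cells t.+1) #|cells t| (@set_mnm V) (@set_mnm V)
    (fun k => set_mnm (enum_val k)) inc (fun S k => inc S (enum_val k))) => //.
- by move=> S k; apply: inc_compat.
- by move=> U k UX; apply: boundary_square UX (enum_valP k).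
move=> a x x0.
have [T TX|y yP] := @acyclic (mnm_support a) t x.
  have TC : T \in cells t by move: TX; rewrite cells_inE => /andP[].
  by rewrite -sum_cells_in -{2}(x0 (enum_rank_in TC T)) enum_rankK_in.
exists y => S SX; rewrite set_mnm_le sum_cells_in => SW.
by apply: yP; rewrite cells_inE SX.
Qed.

(** Minimality holds because passing to a face removes exactly one variable. *)
Lemma cell_complex_minimal :
  minimal_free_resolution cell_complex
    (ideal_gen (fun g => exists2 S, S \in cells 0 & g = 'X_[set_mnm S])).
Proof.
split.
- split=> [j | t i j].
    apply: (@hom_mx_homog _ _ _ _ _ (fun=> 0%MM)) => i k _.
    by apply/mnm_lepP => l; rewrite mnm0E.
  by apply: hom_mx_homog => {}i {}j; rewrite mxE; apply: inc_compat.
- exists #|{: V}| => t lt_t; apply: eq_card0 => S; rewrite !inE.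
  apply/negP => /andP[_ /eqP cS].
  by move: (max_card (mem S)); rewrite leqNgt cS (leq_trans lt_t) // leq_addl.
- exact: cell_complex_resolves.
move=> t i j; rewrite !mxE mcoeffZ mcoeffX.
have [-> | nz] := eqVneq (inc (enum_val i) (enum_val j)) 0; first by rewrite mul0r.
have [x xU ->] := incidence_neq0P nz.
by rewrite (set_mnmD1 xU) addmC addmK mnm1_eq0 mulr0.
Qed.

End CellComplex.
(** * Cells of a poset ideal of isotone maps *)

Section PosetCells.
Variables (K : fieldType) (d : Order.disp_t) (P : finPOrderType d) (n : nat).
Variables (A : P -> {set 'I_n}) (AA : {set {ffun P -> 'I_n}}) (q : P -> nat).
Hypothesis q_inj : injective q.
Hypothesis q_mono : forall x y : P, (x < y)%O -> (q x < q y)%N.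
Hypothesis AA_isotone : forall f, f \in AA -> isotone f.
Hypothesis AA_in : forall f x, f \in AA -> f x \in A x.
Hypothesis AA_down : forall f g, f \in AA -> isotone g ->
  (forall x, g x \in A x) -> (forall x, (g x <= f x)%N) -> g \in AA.

Local Notation V := (P * 'I_n)%type.
Implicit Types (S T U W : {set V}) (f g : {ffun P -> 'I_n}).

(** Elements of one fibre are consecutive for this order, which makes the
    augmentation by 1 on every vertex compatible with the signs. *)
Definition lex_lt : rel V := fun v w =>
  (q v.1 < q w.1)%N || ((v.1 == w.1) && (v.2 < w.2)%N).

Lemma lex_lt_tournament v w : v != w -> lex_lt v w = ~~ lex_lt w v.
Proof.
case: v w => x a [y b]; rewrite xpair_eqE /lex_lt /=.
have [<- | ne _] := eqVneq x y; first by rewrite ltnn /= -leqNgt ltn_neqAle => ->.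
by rewrite !orbF -leqNgt ltn_neqAle (inj_eq q_inj) ne.
Qed.

Local Notation inc := (incidence K lex_lt).

Definition graph f : {set V} := [set v | v.2 == f v.1].

(** The tuples [(B_i)] of the theorem, encoded as the sets of all [(p_i, a)] with
    [a] in [B_i].  The condition on the fibrewise maximum is stated through a
    witness [f] whose graph lies in [S] and dominates [S]; this also forces all
    fibres to be non-empty. *)
Definition poset_cells : {set {set V}} := [set S : {set V} |
  [&& [forall v in S, v.2 \in A v.1],
      [forall v in S, forall w in S, (v.1 < w.1)%O ==> (v.2 <= w.2)%N]
    & [exists f in AA, (graph f \subset S) && [forall v in S, (v.2 <= f v.1)%N]]]].

Local Notation X := (cells poset_cells #|P|).
Local Notation XW := (cells_in poset_cells #|P|).

Lemma poset_cellsP S : reflect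
  [/\ forall x a, (x, a) \in S -> a \in A x,
      forall x y a b, (x, a) \in S -> (y, b) \in S -> (x < y)%O -> (a <= b)%N
    & exists f, [/\ f \in AA, forall x, (x, f x) \in S
                  & forall x a, (x, a) \in S -> (a <= f x)%N]]
  (S \in poset_cells).
Proof.
rewrite inE; apply: (iffP and3P) => [[sA ch ex] | [sA ch [f [fAA gf mf]]]].
  split.
  - by move=> x a xa; apply: (forall_inP sA (x, a)).
  - move=> x y a b xa yb xy.
    exact: (implyP (forall_inP (forall_inP ch (x, a) xa) (y, b) yb)).
  case/exists_inP: ex => f fAA /andP[gf mf]; exists f; split=> //.
    by move=> x; apply: (subsetP gf); rewrite inE.
  by move=> x a xa; apply: (forall_inP mf (x, a)).
split.
- by apply/forall_inP => -[x a]; apply: sA.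
- apply/forall_inP => -[x a] xa; apply/forall_inP => -[y b] yb; apply/implyP.
  exact: ch.
apply/exists_inP; exists f => //; apply/andP; split.
  by apply/subsetP => -[x a]; rewrite inE => /eqP /= ->.
by apply/forall_inP => -[x a]; apply: mf.
Qed.

Lemma isotoneP f : reflect (forall x y : P, (x < y)%O -> (f x <= f y)%N) (isotone f).
Proof.
apply: (iffP forallP) => [h x y /Order.POrderTheory.ltW | h x].
  exact: (implyP (forallP (h x) y)).
apply/forallP => y; apply/implyP; rewrite Order.POrderTheory.le_eqVlt.
by case/orP => [/eqP -> // | /h].
Qed.

(** Every set with non-empty fibres inside a cell is a cell: its fibrewise
    maximum is again isotone and lies below that of the cell. *)
Lemma poset_cells_sub S T : S \in poset_cells -> T \subset S ->
  (forall x, exists a, (x, a) \in T) -> T \in poset_cells.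
Proof.
move=> /poset_cellsP[sA ch [f [fAA gf mf]]] sTS ne.
have /fin_all_exists[g0 g0P] x :
    exists a, (x, a) \in T /\ forall b, (x, b) \in T -> (b <= a)%N.
  have [a0 a0T] := ne x.
  have [//|a aT aM] := @arg_maxnP _ a0 [pred a | (x, a) \in T] (@nat_of_ord n).
  by exists a.
have sT x a : (x, a) \in T -> (x, a) \in S by apply: (subsetP sTS).
apply/poset_cellsP; split.
- by move=> x a /sT; apply: sA.
- by move=> x y a b /sT xa /sT; apply: ch.
have g0S x : (x, g0 x) \in S by apply/sT/(g0P x).1.
exists (finfun g0); split.
- apply: (AA_down fAA).
  + by apply/isotoneP => x y xy; rewrite !ffunE; apply: (ch x y).
  + by move=> x; rewrite ffunE; apply: sA.
  + by move=> x; rewrite ffunE; apply: mf.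
- by move=> x; rewrite ffunE; apply: (g0P x).1.
by move=> x a; rewrite ffunE; apply: (g0P x).2.
Qed.

Lemma fiber_nonempty S x : S \in poset_cells -> exists a, (x, a) \in S.
Proof. by case/poset_cellsP => _ _ [f [_ gf _]]; exists (f x). Qed.

Lemma poset_cells_convex T S U : T \in poset_cells -> U \in poset_cells ->
  T \subset S -> S \subset U -> S \in poset_cells.
Proof.
move=> Tc Uc TS SU; apply: (poset_cells_sub Uc SU) => x.
by have [a aT] := fiber_nonempty x Tc; exists a; apply: (subsetP TS).
Qed.

Lemma card_graph f : #|graph f| = #|P|.
Proof.
rewrite -(card_imset (mem P) (f := fun x => (x, f x))); last by move=> x y [].
apply: eq_card => -[x a]; rewrite inE /=.
apply/eqP/imsetP => [-> | [y _ [-> ->]] //].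
by exists x.
Qed.

Lemma graph_cell f : f \in AA -> graph f \in poset_cells.
Proof.
move=> fAA; apply/poset_cellsP; split.
- by move=> x a; rewrite inE => /eqP /= ->; apply: AA_in.
- move=> x y a b; rewrite !inE /= => /eqP -> /eqP -> xy.
  exact: (isotoneP _ (AA_isotone fAA)).
exists f; split=> // [x | x a]; rewrite inE //=.
by move=> /eqP ->.
Qed.

Lemma graph_sub S f : (forall x, (x, f x) \in S) -> graph f \subset S.
Proof. by move=> gf; apply/subsetP => -[x a]; rewrite inE => /eqP /= ->. Qed.

(** The vertices of the complex are the generators of the ideal. *)
Lemma cells0P S : reflect (exists2 f, f \in AA & S = graph f) (S \in X 0).
Proof.
rewrite inE addn0; apply: (iffP andP) => [[Sc /eqP cS] | [f fAA ->]]; last first.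
  by rewrite graph_cell // card_graph.
have /poset_cellsP[_ _ [f [fAA gf _]]] := Sc; exists f => //.
by apply/esym/eqP; rewrite eqEcard cS card_graph leqnn andbT graph_sub.
Qed.

Lemma card_poset_cell S : S \in poset_cells -> (#|P| <= #|S|)%N.
Proof.
case/poset_cellsP => _ _ [f [_ gf _]].
by rewrite -(card_graph f) subset_leq_card // graph_sub.
Qed.

(** An edge has a single fibre with two elements, and these are adjacent for
    [lex_lt]; so its two vertices occur in its boundary with opposite signs. *)
Lemma poset_augmentation U : U \in X 1 -> \sum_(S in X 0) inc U S = 0.
Proof.
rewrite inE addn1 => /andP[Uc /eqP cU].
have /poset_cellsP[_ _ [f [fAA gf mf]]] := Uc.
have /eqP/cards1P[[x b] eU] : #|U :\: graph f| = 1%N.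
  rewrite cardsD cU (setIidPr _) ?graph_sub // card_graph subSn // subnn //.
have [xbU ne_b] : (x, b) \in U /\ b != f x.
  by move/setP/(_ (x, b)): eU; rewrite !inE eqxx /= => /andP[].
have lt_b : (b < f x)%N by rewrite ltn_neqAle (inj_eq val_inj) ne_b mf.
have UE y c : (y, c) \in U -> c = f y \/ (y, c) = (x, b).
  move=> ycU; have /setP/(_ (y, c)) := eU; rewrite !inE ycU andbT /=.
  by case: eqVneq => [-> | _ /esym/eqP]; [left | right].
have faceP y : y != x -> U :\ (y, f y) \notin X 0.
  move=> ne; rewrite inE negb_and; apply/orP; left; apply/negP.
  move/(fiber_nonempty y) => [c]; rewrite !inE => /andP[ne_c /UE[ec | [yx _]]].
    by rewrite ec eqxx in ne_c.
  by rewrite yx eqxx in ne.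
have face1 v : v \in U -> (forall y, exists a, (y, a) \in U :\ v) -> U :\ v \in X 0.
  move=> vU ne; rewrite inE addn0 (poset_cells_sub Uc (subD1set _ _) ne) /=.
  by move: cU; rewrite (cardsD1 v) vU add1n => -[->].
have facexb : U :\ (x, b) \in X 0.
  apply: face1 => // y; exists (f y).
  rewrite !inE gf andbT xpair_eqE negb_and -implybE; apply/implyP => /eqP ->.
  by rewrite eq_sym.
have facexf : U :\ (x, f x) \in X 0.
  apply: face1 => // y; have [-> | ne] := eqVneq y x.
    by exists b; rewrite !inE xbU andbT xpair_eqE eqxx.
  by exists (f y); rewrite !inE gf andbT xpair_eqE (negPf ne).
transitivity (\sum_S inc U S * (S \in X 0)%:R).
  rewrite big_mkcond; apply: eq_bigr => S _.
  by case: (S \in X 0); rewrite ?mulr1 ?mulr0.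
rewrite incidence_sum (bigD1 (x, b)) //= (bigD1 (x, f x)) /=; last first.
  by rewrite gf xpair_eqE eqxx eq_sym.
rewrite facexb facexf !mulr1 big1 ?addr0; last first.
  move=> [y c] /andP[/andP[/UE[-> | ->]]]; last by rewrite eqxx.
  move=> _; have [-> | ne _] := eqVneq y x; first by rewrite eqxx.
  by rewrite (negPf (faceP y ne)) mulr0.
rewrite /face_sign [X in _ + (-1) ^+ X](cardsD1 (x, b)) inE xbU /lex_lt /= eqxx lt_b orbT.
rewrite exprS mulN1r; apply/eqP; rewrite subr_eq0; apply/eqP.
congr (_ ^+ #|pred_of_set _|); apply/setP => -[y c]; rewrite !inE /= xpair_eqE.
case ycU: ((y, c) \in U); rewrite ?andbF //=.
have [eyx | ne] /= := eqVneq y x; last by rewrite !orbF.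
rewrite {}eyx in ycU *.
rewrite ltnn /=; case: (UE _ _ ycU) => [-> | [->]].
  by rewrite ltnn andbF ltnNge (ltnW lt_b).
by rewrite ltnn eqxx.
Qed.

(** The fibrewise minimum of all cells inside [W] is isotone and lies below
    every cell, hence belongs to the poset ideal. *)
Lemma bottom_map W S0 : S0 \in poset_cells -> S0 \subset W ->
  exists f0, [/\ f0 \in AA, graph f0 \subset W
    & forall S, S \in poset_cells -> S \subset W ->
        forall x a, (x, a) \in S -> (f0 x <= a)%N].
Proof.
move=> S0c S0W.
pose C := [set S in poset_cells | S \subset W].
have /fin_all_exists[g0 g0P] x : exists a, (exists2 S, S \in C & (x, a) \in S) /\
    forall S b, S \in C -> (x, b) \in S -> (a <= b)%N.
  have [a0 a0S] := fiber_nonempty x S0c.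
  have [|a /exists_inP[S SC aS] aM] := @arg_minnP _ a0
      [pred a | [exists S in C, (x, a) \in S]] (@nat_of_ord n).
    by apply/exists_inP; exists S0 => //; rewrite inE S0c.
  exists a; split; first by exists S.
  by move=> T b TC bT; apply: aM; apply/exists_inP; exists T.
have inC S : S \in C -> S \in poset_cells /\ S \subset W by rewrite inE => /andP[].
have g0A x : g0 x \in A x.
  by have [[S /inC[/poset_cellsP[sA _ _] _] /sA]] := g0P x.
have S0C : S0 \in C by rewrite inE S0c.
exists (finfun g0); split.
- have /poset_cellsP[_ _ [f [fAA gf _]]] := S0c.
  apply: (AA_down fAA) => [|x|x]; rewrite ?ffunE //; last by apply: (g0P x).2 (gf x).
  apply/isotoneP => x y xy; rewrite !ffunE.
  have [[S SC yS] _] := g0P y; have [Sc _] := inC S SC.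
  have [a aS] := fiber_nonempty x Sc; apply: leq_trans ((g0P x).2 S a SC aS) _.
  by have /poset_cellsP[_ ch _] := Sc; apply: ch xy.
- apply: graph_sub => x; rewrite ffunE.
  by have [[S /inC[_ SW] xS] _] := g0P x; apply: (subsetP SW).
by move=> S Sc SW x a xa; rewrite ffunE; apply: ((g0P x).2 S a) => //; rewrite inE Sc.
Qed.

(** * The matching of the cells inside a set of variables *)

Section Toggle.
Variables (W : {set V}) (f0 : {ffun P -> 'I_n}).
Hypothesis f0AA : f0 \in AA.
Hypothesis f0W : graph f0 \subset W.
Hypothesis f0_min : forall S, S \in poset_cells -> S \subset W ->
  forall x a, (x, a) \in S -> (f0 x <= a)%N.

Definition trivial_fiber S x := [forall a, ((x, a) \in S) == (a == f0 x)].

(** The pivot is the first element, in the order given by [q], over which [S]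
    differs from the graph of [f0]; only the graph of [f0] has none. *)
Definition pivot S x :=
  ~~ trivial_fiber S x && [forall y, (q y < q x)%N ==> trivial_fiber S y].

(** The default branch is the case of the graph of [f0], the one set without a
    pivot. *)
Definition toggle_up S := if [pick x | pivot S x] is Some x then (x, f0 x) |: S else S.

Definition pivot_rank S := if [pick x | pivot S x] is Some x then q x else 0%N.

(** The cells to which [f0] of the pivot can be added. *)
Definition lower_cells t :=
  [set S in XW W t | [exists x, pivot S x && ((x, f0 x) \notin S)]].

Lemma trivial_fiberP S x :
  reflect (forall a, ((x, a) \in S) = (a == f0 x)) (trivial_fiber S x).
Proof. by apply: (iffP forallP) => h a; apply/eqP. Qed.

Lemma pivot_below S x y : pivot S x -> (q y < q x)%N ->
  forall a, ((y, a) \in S) = (a == f0 y).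
Proof. by case/andP => _ /forallP/(_ y)/implyP h /h/trivial_fiberP. Qed.

Lemma pivot_uniq S x y : pivot S x -> pivot S y -> x = y.
Proof.
case/andP => nx /forallP hx /andP[ny /forallP hy].
have [lt|lt|/q_inj //] := ltngtP (q x) (q y).
  by rewrite (implyP (hy x)) in nx.
by rewrite (implyP (hx y)) in ny.
Qed.

Lemma pick_pivot S x : pivot S x -> [pick y | pivot S y] = Some x.
Proof.
move=> px; case: pickP => [y py | /(_ x)]; last by rewrite px.
by rewrite (pivot_uniq px py).
Qed.

Lemma pivot_exists S : S != graph f0 -> exists x, pivot S x.
Proof.
move=> ne; have [x0 nx0] : exists x, ~~ trivial_fiber S x.
  apply/existsP; rewrite -negb_forall; apply: contra ne => /forallP triv.
  apply/eqP/setP => -[x a]; rewrite inE /=.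
  exact: (trivial_fiberP _ _ (triv x)).
have [//|x nx xm] := @arg_minnP _ x0 [pred x | ~~ trivial_fiber S x] q.
exists x; apply/andP; split; first exact: nx.
apply/forallP => y; apply/implyP; rewrite ltnNge.
by apply: contraR => /xm.
Qed.

Lemma pivot_eq S T x : pivot S x -> ~~ trivial_fiber T x ->
  (forall y a, y != x -> ((y, a) \in T) = ((y, a) \in S)) -> pivot T x.
Proof.
move=> px nt eqTS; rewrite /pivot nt /=; apply/forallP => y; apply/implyP => lt.
apply/trivial_fiberP => a; rewrite eqTS ?(pivot_below px lt) //.
by apply: contraTneq lt => ->; rewrite ltnn.
Qed.

Lemma lower_cellsP t S : S \in lower_cells t -> exists x,
  [/\ S \in poset_cells, S \subset W, #|S| = (#|P| + t)%N, pivot S x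
    & [/\ (x, f0 x) \notin S, toggle_up S = (x, f0 x) |: S & pivot_rank S = q x]].
Proof.
rewrite inE => /andP[+ /existsP[x /andP[px nx]]].
rewrite mem_cells_in => /and3P[Sc /eqP cS SW]; exists x.
by rewrite /toggle_up /pivot_rank (pick_pivot px).
Qed.

Lemma mem_lower t S x : S \in poset_cells -> S \subset W -> #|S| = (#|P| + t)%N ->
  pivot S x -> (x, f0 x) \notin S -> S \in lower_cells t.
Proof.
move=> Sc SW cS px nx; rewrite inE mem_cells_in Sc cS eqxx SW /=.
by apply/existsP; exists x; rewrite px.
Qed.

(** Adding the minimum of the pivot fibre keeps the order conditions: the fibres
    over smaller elements are trivial, and all values above are at least
    those of the bottom map. *)
Lemma toggle_up_cell t S : S \in lower_cells t -> toggle_up S \in XW W t.+1.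
Proof.
case/lower_cellsP => x [Sc SW cS px [nx -> _]].
rewrite mem_cells_in cardsU1 nx cS addnS add1n eqxx; apply/andP; split; last first.
  by rewrite subUset SW sub1set andbT; apply: (subsetP f0W); rewrite inE.
have /poset_cellsP[sA ch [f [fAA gf mf]]] := Sc.
have f0iso := isotoneP _ (AA_isotone f0AA).
apply/poset_cellsP; split.
- by move=> y a; rewrite !inE => /orP[/eqP[-> ->] | /sA //]; apply: AA_in.
- move=> y z a b; rewrite !inE => /orP[/eqP[-> ->] | ya] /orP[/eqP[-> ->] | zb] yz.
  + by rewrite Order.POrderTheory.ltxx in yz.
  + by apply: leq_trans (f0_min Sc SW zb); apply: f0iso.
  + move: ya; rewrite (pivot_below px (q_mono yz)) => /eqP ->.
    exact: f0iso.
  + exact: ch yz.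
exists f; split=> // [y | y a]; rewrite !inE ?gf ?orbT //.
by case/orP => [/eqP[-> ->] | /mf //]; apply: (f0_min Sc SW).
Qed.

(** Let [x] be the pivot of [S].  A face of [toggle_up S] other than [S] contains
    [(x, f0 x)], and its non-empty fibres below [x] are still trivial.  If it
    is a lower cell, its pivot fibre misses the value of [f0], so its pivot comes
    after [x]. *)
Lemma lower_cells_triangular t :
  triangular (lower_cells t) (fun S S' => inc (toggle_up S) S') pivot_rank.
Proof.
split=> [S /lower_cellsP[x [Sc SW cS px [nx -> _]]] | S S'].
  have {2}-> : S = ((x, f0 x) |: S) :\ (x, f0 x) by rewrite setU1K.
  by rewrite incidence_face_neq0 // setU11.
case/lower_cellsP => x [Sc SW cS px [nx -> ->]].
case/lower_cellsP => x' [Sc' SW' cS' px' [nx' _ ->]] ne /incidence_neq0P[[y b] ybU eS'].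
have S'E z a : ((z, a) \in S') = ((z, a) != (y, b)) && (((z, a) == (x, f0 x)) || ((z, a) \in S)).
  by rewrite eS' !inE.
have ne_yb : (y, b) != (x, f0 x).
  by apply: contra ne => /eqP e; rewrite eS' e setU1K.
have ybS : (y, b) \in S by move: ybU; rewrite !inE (negPf ne_yb).
have xS' : (x, f0 x) \in S' by rewrite S'E eqxx eq_sym ne_yb.
rewrite ltnNge; apply/negP => le_q.
have [e | ne_x] := eqVneq x' x; first by rewrite -e in xS'; rewrite xS' in nx'.
have {le_q}lt_q : (q x' < q x)%N by rewrite ltn_neqAle (inj_eq q_inj) ne_x.
have [c xcS'] := fiber_nonempty x' Sc'; case/negP: nx'.
suff <- : c = f0 x' by [].
move: xcS'; rewrite S'E => /andP[_ /orP[/eqP[ex _] | ]]; first by rewrite ex eqxx in ne_x.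
by rewrite (pivot_below px lt_q) => /eqP.
Qed.

(** The inverse of [toggle_up]: the pivot fibre is not reduced to its minimum
    [f0 x], so removing the latter leaves a cell with the same pivot. *)
Lemma upper_cell t S x : S \in XW W t -> pivot S x -> (x, f0 x) \in S ->
  exists T, [/\ T \in poset_cells, T \subset W, #|T|.+1 = (#|P| + t)%N
    & [/\ pivot T x, (x, f0 x) \notin T & S = (x, f0 x) |: T]].
Proof.
rewrite mem_cells_in => /and3P[Sc /eqP cS SW] px xS.
pose T := S :\ (x, f0 x).
have [b ne_b xbS] : exists2 b, b != f0 x & (x, b) \in S.
  case/andP: (px) => /forallPn[b nb] _; exists b.
    by apply/eqP => e; rewrite e xS eqxx in nb.
  case xbS: ((x, b) \in S) => //; rewrite xbS eq_sym eqbF_neg negbK in nb.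
  by rewrite (eqP nb) xS in xbS.
have nT : (x, f0 x) \notin T by rewrite !inE eqxx.
exists T; split.
- apply: (poset_cells_sub Sc); rewrite ?subD1set // => y.
  have [-> | ne] := eqVneq y x; first by exists b; rewrite !inE xpair_eqE eqxx ne_b.
  have [a aS] := fiber_nonempty y Sc.
  by exists a; rewrite !inE xpair_eqE (negPf ne).
- exact: subset_trans (subD1set _ _) SW.
- by rewrite -cS [RHS](cardsD1 (x, f0 x)) xS.
split=> //; last by rewrite setD1K.
apply: (pivot_eq px) => [|y a ne]; last by rewrite !inE xpair_eqE (negPf ne).
by apply/negP => /trivial_fiberP/(_ (f0 x)); rewrite (negPf nT) eqxx.
Qed.

Lemma lower_upper t S : S \in XW W t.+1 ->
  S \in lower_cells t.+1 \/ exists2 T, T \in lower_cells t & S = toggle_up T.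
Proof.
move=> SX; have [|x px] := @pivot_exists S.
  move: SX; rewrite mem_cells_in => /and3P[_ cS _]; apply: contraTneq cS => ->.
  by rewrite card_graph -{1}[#|P|]addn0 eqn_add2l.
have [xS | nx] := boolP ((x, f0 x) \in S); [right | left]; last first.
  by rewrite inE SX; apply/existsP; exists x; rewrite px.
have [T [Tc TW cT [pT nT eS]]] := upper_cell SX px xS.
exists T; last by rewrite /toggle_up (pick_pivot pT).
by apply: (mem_lower Tc TW _ pT nT); apply/eqP; rewrite -eqSS cT addnS.
Qed.

(** A vertex is never an upper partner, since a cell has at least [#|P|]
    elements; the graph of [f0] is the only unmatched cell. *)
Lemma lower_upper0 S : S \in XW W 0 -> S \in lower_cells 0 \/ S = graph f0.
Proof.
move=> SX; have [-> | /pivot_exists[x px]] := eqVneq S (graph f0); first by right.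
left; rewrite inE SX; apply/existsP; exists x; rewrite px /=; apply/negP => xS.
have [T [/card_poset_cell + _ cT _]] := upper_cell SX px xS.
by rewrite -ltnS cT addn0 ltnn.
Qed.

Lemma lower_sub t : lower_cells t \subset XW W t.
Proof. by apply/subsetP => S; rewrite inE => /andP[]. Qed.

Lemma matched_acyclic t (x : {set V} -> K) :
  (forall T, T \in XW W t -> \sum_(S in XW W t.+1) x S * inc S T = 0) ->
  exists y : {set V} -> K, forall S, S \in XW W t.+1 ->
    x S = \sum_(U in XW W t.+2) y U * inc U S.
Proof.
apply: (matching_exact (lower_sub t.+1) (@toggle_up_cell t.+1) (lower_sub t)
  (@toggle_up_cell t) (@lower_upper t) (lower_cells_triangular t.+1)
  (lower_cells_triangular t)).
move=> U T; rewrite inE [T \in _]inE => /andP[UX UW] /andP[TX _].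
rewrite sum_faces_in //.
exact: (boundary_square K lex_lt_tournament poset_cells_convex UX TX).
Qed.

(** The unmatched vertex [graph f0] is the partner of the single cell [tt] that
    represents the degree 0 generator of the augmented complex. *)
Lemma matched_acyclic0 (x : {set V} -> K) : \sum_(S in XW W 0) x S = 0 ->
  exists y : {set V} -> K, forall S, S \in XW W 0 ->
    x S = \sum_(U in XW W 1) y U * inc U S.
Proof.
move=> x0; apply: (@matching_exact K _ _ unit (XW W 1) (XW W 0) [set tt] inc
  (fun _ _ => 1) (lower_cells 0) [set tt] toggle_up (fun=> graph f0) pivot_rank
  (fun=> 0%N)) => //.
- exact: lower_sub.
- exact: toggle_up_cell.
- by move=> T _; rewrite inE f0W andbT; apply/cells0P; exists f0.
- by move=> S /lower_upper0[|->]; [left | right; exists tt; rewrite ?inE].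
- exact: lower_cells_triangular.
- by split=> [|[] []]; rewrite ?oner_eq0.
- move=> U T; rewrite inE => /andP[UX UW] _.
  rewrite sum_faces_in // -[RHS](poset_augmentation UX).
  by apply: eq_bigr => S _; rewrite mulr1.
by move=> T _; rewrite -[RHS]x0; apply: eq_bigr => S _; rewrite mulr1.
Qed.

End Toggle.

Lemma poset_cells_resolution : minimal_free_resolution
  (cell_complex K lex_lt poset_cells #|P|)
  (ideal_gen (fun u => exists2 S, S \in X 0 & u = 'X_[set_mnm S])).
Proof.
apply: (cell_complex_minimal lex_lt_tournament poset_cells_convex
  poset_augmentation).
- move=> W t x x0.
  have [S0 S0X | none] := pickP (mem (XW W t.+1)); last first.
    by exists (fun=> 0) => S SX; move: (none S); rewrite /= SX.
  move: (S0X); rewrite /= mem_cells_in => /and3P[S0c _ S0W].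
  have [f0 [f0AA f0W f0m]] := bottom_map S0c S0W.
  exact: matched_acyclic f0AA f0W f0m _ _ x0.
move=> W x x0.
have [S0 S0X | none] := pickP (mem (XW W 0)); last first.
  by exists (fun=> 0) => S SX; move: (none S); rewrite /= SX.
move: (S0X); rewrite /= mem_cells_in => /and3P[S0c _ S0W].
have [f0 [f0AA f0W f0m]] := bottom_map S0c S0W.
exact: matched_acyclic0 f0AA f0W f0m _ x0.
Qed.

End PosetCells.
(** * Minimal generators of homological shift ideals *)

Lemma ideal_gen_ext (R : comNzRingType) (S S' : R -> Prop) f :
  (forall g, S g <-> S' g) -> ideal_gen S f <-> ideal_gen S' f.
Proof.
move=> e; split=> -[r [c [g [gS ->]]]]; exists r, c, g; split=> // i; exact/e.
Qed.

Section ShiftIdeals.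
Variables (K : fieldType) (N : nat).
Implicit Types (I J G : {mpoly K[N]} -> Prop).

Lemma minimal_generating_set_ext J J' G G' :
  (forall f, J f <-> J' f) -> (forall g, G g <-> G' g) ->
  minimal_generating_set J G -> minimal_generating_set J' G'.
Proof.
move=> eJ eG [mon gen mini]; split=> [g /eG /mon // | f | H HG genH g /eG Gg].
  by rewrite -eJ gen; apply: ideal_gen_ext.
apply: mini => // [h /HG /eG // | f].
by rewrite eJ.
Qed.

Lemma minimal_free_resolution_ext F I I' : (forall f, I f <-> I' f) ->
  minimal_free_resolution F I -> minimal_free_resolution F I'.
Proof.
move=> e [mF fF [gF e0 e1] minF]; split=> //; split=> // f.
by rewrite -e.
Qed.

(** Monomials of one and the same total degree never divide each other unless
    they are equal, so none of them is redundant. *)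
Lemma equigenerated_minimal G D :
  (forall g, G g -> exists2 u : 'X_{1..N}, g = 'X_[u] & mdeg u = D) ->
  minimal_generating_set (ideal_gen G) G.
Proof.
move=> monG; split=> // [g /monG[u -> _] | H HG genH g Gg]; first by exists u.
have [u eg du] := monG g Gg.
have /genH[r [c [h [hH eqg]]]] : ideal_gen G g.
  by exists 1%N, (fun=> 1), (fun=> g); rewrite big_ord1 mul1r.
have [i nz] : exists i, (c i * h i)@_u != 0.
  apply/existsP; rewrite -[X in is_true X]negbK negb_exists; apply/negP => /forallP z.
  move/(congr1 (mcoeff u)): eqg; rewrite eg mcoeffX eqxx raddf_sum /= big1.
    by move/eqP; rewrite oner_eq0.
  by move=> i _; apply/eqP; move: (z i); rewrite negbK.
have [w ew dw] := monG _ (HG _ (hH i)).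
move: nz; rewrite ew mcoeffMX_le; case: ifP => [le_wu _ | ]; last by rewrite eqxx.
have : mdeg (u - w) == 0%N.
  by rewrite -(eqn_add2r (mdeg w)) -mdegD submK // du dw.
rewrite mdeg_eq0 => /eqP uw0; have eu : u = w by rewrite -(submK le_wu) uw0 add0m.
by rewrite eg eu -ew; apply: hH.
Qed.

(** Every minimal resolution computes the homological shift ideal, by uniqueness
    of the multidegrees. *)
Lemma HS_generators F I t : minimal_free_resolution F I ->
  forall f, HS t I f <->
    ideal_gen (fun g => exists j : 'I_(frank F t), g = 'X_[fshift j]) f.
Proof.
move=> rF f; split=> [[H [rH [r [c [g [gH ->]]]]]] | fF]; last by exists F.
exists r, c, g; split=> // i; have [j ->] := gH i.
case: rH rF => mH _ resH minH [mF _ resF _].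
by have [k ->] := shift_minimal mH mF resH resF minH j; exists k.
Qed.

End ShiftIdeals.

(** * Cells and tuples of subsets *)

Section Assembly.
Variables (K : fieldType) (d : Order.disp_t) (P : finPOrderType d) (n : nat).

Lemma set_mnm_sum (V : finType) (S : {set V}) :
  set_mnm S = (\sum_(v in S) U_(enum_rank v))%MM.
Proof.
apply/mnmP => i; rewrite mnmE mnm_sumE.
rewrite (eq_bigr (fun v => if v == enum_val i then 1 else 0)%N); last first.
  move=> v _; rewrite mnm1E -{1}(enum_valK i) (inj_eq enum_rank_inj).
  by case: eqP.
rewrite -big_mkcondr /=; case: (boolP (enum_val i \in S)) => [iS | niS].
  rewrite (big_pred1 (enum_val i)) // => v /=.
  by apply/andP/eqP => [[_ /eqP] // | ->]; rewrite iS eqxx.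
rewrite big_pred0 // => v; apply: contraNF niS => /andP[vS /eqP <-].
by [].
Qed.

Lemma cell_monomial (S : {set P * 'I_n}) :
  'X_[set_mnm S] = \prod_x \prod_(a | (x, a) \in S) Xvar K x a.
Proof.
rewrite set_mnm_sum -mprodXE (pair_big_dep predT (fun x a => (x, a) \in S)) /=.
by apply: eq_big => -[x a].
Qed.

Lemma Umon_graph (f : {ffun P -> 'I_n}) : Umon K f = 'X_[set_mnm (graph f)].
Proof.
rewrite cell_monomial; apply: eq_bigr => x _; rewrite (big_pred1 (f x)) // => a.
by rewrite inE.
Qed.

Lemma leq_set_max (B : {set 'I_n}) a : a \in B -> (a <= set_max B)%N.
Proof. by move=> aB; rewrite /set_max (bigD1 a) //= leq_maxl. Qed.

Lemma set_min_leq (B : {set 'I_n}) a : a \in B -> (set_min B <= a)%N.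
Proof.
move=> aB; rewrite /set_min; move: (mem_index_enum a).
elim: (index_enum _) => //= b r IH; rewrite inE big_cons => /orP[/eqP <- | /IH le].
  by rewrite aB geq_minl.
by case: ifP => // _; rewrite geq_min le orbT.
Qed.

Lemma set_max_leq_set_min (B C : {set 'I_n}) :
  (forall a b, a \in B -> b \in C -> (a <= b)%N) -> (set_max B <= set_min C)%N.
Proof.
move=> le; apply/bigmax_leqP => a aB; rewrite /set_min.
elim/big_ind: _ => [|x y ax ay|b bC]; [exact: ltnW | by rewrite leq_min ax | exact: le].
Qed.

Lemma set_max_eq (B : {set 'I_n}) (c : 'I_n) :
  c \in B -> (forall a, a \in B -> (a <= c)%N) -> c = set_max B :> nat.
Proof.
move=> cB cM; apply/eqP; rewrite eqn_leq leq_set_max //=.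
exact/bigmax_leqP.
Qed.

Lemma set_max_mem (B : {set 'I_n}) (c : 'I_n) :
  B != set0 -> c = set_max B :> nat -> c \in B.
Proof.
rewrite -card_gt0 => B0.
have [a aB e] := eq_bigmax_cond (fun a : 'I_n => a : nat) B0.
by rewrite /set_max e => /val_inj ->.
Qed.

End Assembly.

Theorem theorem3p4 (K : fieldType) (n m : nat)
    (d : Order.disp_t) (P : finPOrderType d) (p : 'I_m -> P)
    (A : 'I_m -> {set 'I_n}) (AA : {set {ffun P -> 'I_n}}) (t : nat) :
  (0 < n)%N ->
  bijective p ->
  (forall i j : 'I_m, (p i < p j)%O -> (i < j)%N) ->
  (forall i, A i != set0) ->
  poset_ideal (@Hom_le d P n) (HomPA p A) AA ->
  minimal_generating_set (HS t (Lideal K AA))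
    (fun g => exists B : 'I_m -> {set 'I_n},
       [/\ forall i, B i != set0 /\ B i \subset A i,
           forall i j, (p i < p j)%O -> (set_max (B i) <= set_min (B j))%N,
           (\sum_(i < m) #|B i| = m + t)%N,
           exists2 f, f \in AA & forall i, f (p i) = set_max (B i) :> nat
         & g = (\prod_(i < m) XvarS K (p i) (B i))%R]).
Proof.
move=> _ p_bij p_mono _ [_ sAA dAA]; have [p' pK p'K] := p_bij.
pose q x : nat := p' x; pose A' x := A (p' x).
have q_inj : injective q by move=> x y /val_inj /(can_inj p'K).
have q_mono x y : (x < y)%O -> (q x < q y)%N.
  by move=> xy; apply: p_mono; rewrite !p'K.
have AA_iso f : f \in AA -> isotone f.
  by move=> /(subsetP sAA); rewrite inE => /andP[].
have AA_in f x : f \in AA -> f x \in A' x.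
  by move=> /(subsetP sAA); rewrite inE => /andP[_ /forallP/(_ (p' x))]; rewrite p'K.
have AA_down f g : f \in AA -> isotone g -> (forall x, g x \in A' x) ->
    (forall x, (g x <= f x)%N) -> g \in AA.
  move=> fAA gi gA gf; apply: (dAA _ f) => //; last exact/forallP.
  by rewrite inE gi; apply/forallP => i; move: (gA (p i)); rewrite /A' pK.
have cardP : #|P| = m by rewrite -[RHS]card_ord; apply/esym/bij_eq_card/p_bij.
pose X := cells (poset_cells A' AA) #|P|.
have res : minimal_free_resolution
    (cell_complex K (lex_lt q) (poset_cells A' AA) #|P|) (Lideal K AA).
  apply: minimal_free_resolution_ext
    (poset_cells_resolution K q_inj q_mono AA_iso AA_in AA_down).
  move=> f; apply: ideal_gen_ext => g.
  split=> [[S /(cells0P AA_iso AA_in)[h hAA ->] ->] | [h hAA ->]].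
    by exists h; rewrite ?Umon_graph.
  exists (graph h); rewrite ?Umon_graph //.
  by apply/(cells0P AA_iso AA_in); exists h.
pose G g := exists2 S, S \in X t & g = 'X_[set_mnm S] :> polyR P n K.
apply: (@minimal_generating_set_ext _ _ (ideal_gen G) _ G).
- move=> f; rewrite (HS_generators t res).
  apply: ideal_gen_ext => g; split=> [[S SX ->] | [j ->]].
    by exists (enum_rank_in SX S); rewrite /= enum_rankK_in.
  by exists (enum_val j); rewrite ?enum_valP.
- move=> g; split; last first.
    case=> B [BA Bch cB [f fAA fB] ->].
    pose S := [set v : P * 'I_n | v.2 \in B (p' v.1)].
    have inS x a : ((x, a) \in S) = (a \in B (p' x)) by rewrite inE.
    exists S.
      rewrite inE; apply/andP; split; last first.
        rewrite cardP -cB -sum1_card; apply/eqP.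
        transitivity (\sum_x \sum_(a | (x, a) \in S) 1)%N.
          rewrite pair_big_dep /=.
          by apply: eq_bigl => -[x a].
        rewrite (reindex p (onW_bij _ p_bij)); apply: eq_bigr => i _.
        by rewrite -sum1_card; apply: eq_bigl => a; rewrite inS pK.
      apply/poset_cellsP; split.
      + by move=> x a; rewrite inS; apply: (subsetP (BA _).2).
      + move=> x y a b; rewrite !inS => aB bB xy.
        apply: leq_trans (leq_set_max aB) _; apply: leq_trans (set_min_leq bB).
        by apply: Bch; rewrite !p'K.
      exists f; split=> // [x | x a].
        by rewrite inS; apply: set_max_mem (BA _).1 _; rewrite -fB p'K.
      by rewrite inS => /leq_set_max; rewrite -fB p'K.
    rewrite cell_monomial (reindex p (onW_bij _ p_bij)); apply: eq_bigr => i _.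
    by apply: eq_bigl => a; rewrite inS pK.
  case=> S + ->; rewrite inE => /andP[Sc /eqP cS].
  pose B i := [set a | (p i, a) \in S].
  have /poset_cellsP[sA ch [f [fAA gf mf]]] := Sc.
  exists B; split.
  + move=> i; split; first by apply/set0Pn; exists (f (p i)); rewrite inE.
    by apply/subsetP => a; rewrite inE => /sA; rewrite /A' pK.
  + move=> i j pij; apply: set_max_leq_set_min => a b; rewrite !inE => aS bS.
    exact: ch pij.
  + rewrite -[X in _ = (X + _)%N]cardP -cS -sum1_card.
    transitivity (\sum_x \sum_(a | (x, a) \in S) 1)%N; last first.
      by rewrite pair_big_dep /=; apply: eq_bigl => -[x a].
    rewrite (reindex p (onW_bij _ p_bij)); apply: eq_bigr => i _.
    by rewrite -sum1_card; apply: eq_bigl => a; rewrite inE.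
  + exists f => // i; apply: set_max_eq => [|a]; rewrite inE //.
    exact: mf.
  rewrite cell_monomial (reindex p (onW_bij _ p_bij)); apply: eq_bigr => i _.
  by apply: eq_bigl => a; rewrite inE.
apply: (@equigenerated_minimal _ _ _ (m + t)) => g [S].
rewrite inE => /andP[_ /eqP cS] ->; exists (set_mnm S) => //.
by rewrite mdeg_set_mnm cS cardP.
Qed.
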